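(* Let $A$ be a commutative $\mathbb{R}$-algebra with $1$ and let $Q$ be a semiordering of $A$. If $Q$ is not archimedean, then $Q^{\ddagger}=\overline{Q}=A$. If $Q$ is archimedean, then there exists a unique ring homomorphism $\alpha:A\to\mathbb{R}$ with $Q\subseteq\alpha^{-1}(\mathbb{R}^+)$, and $Q^{\ddagger}=\overline{Q}=\alpha^{-1}(\mathbb{R}^+)$.
   Context: $\mathbb{R}^+$ denotes the set of nonnegative real numbers. A quadratic module of $A$ is a subset $Q\subseteq A$ with $Q+Q\subseteq Q$, $f^2Q\subseteq Q$ for all $f\in A$, and $1\in Q$. A semiordering of $A$ is a quadratic module $Q$ of $A$ such that $Q\cup -Q=A$ and $Q\cap -Q$ is a prime ideal of $A$. A quadratic module $Q$ is archimedean if for every $f\in A$ there is an integer $k\ge 0$ with $k+f\in Q$. $A$ is endowed, as a real vector space, with the finest locally convex topology (the vector space topology for which all convex, absorbent, symmetric subsets form a zero neighborhood base; $U$ is absorbent if for each $x$ there is $\lambda>0$ with $x\in\lambda U$, and symmetric if $\lambda U\subseteq U$ for all $|\lambda|\le 1$). For $C\subseteq A$, $\overline{C}$ is the closure of $C$ in this topology, and $C^{\ddagger}$ (the sequential closure) is the set of all elements of $A$ that are limits of sequences of elements of $C$. *)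

(* Defs.v *)
From HB Require Import structures.
From mathcomp Require Import all_boot all_order all_algebra.
From mathcomp Require Import interval_inference.
From mathcomp Require Import all_classical all_reals all_analysis.
From mathcomp Require Import lra.
Import numFieldNormedType.Exports.
Import Order.TTheory GRing.Theory Num.Theory.

Set Implicit Arguments.
Unset Strict Implicit.
Unset Printing Implicit Defensive.

Local Open Scope classical_set_scope.
Local Open Scope ring_scope.

Section FinestLocallyConvex.
Context {R : realType}.

Definition absorbent (E : lmodType R) (U : set E) : Prop :=
  forall x, exists2 r : R, 0 < r & (( *:%R r) @` U) x.

Definition symmetric_set (E : lmodType R) (U : set E) : Prop :=
  forall r : R, `|r| <= 1 -> ( *:%R r) @` U `<=` U.

(* The sets declared to form a base of neighborhoods of 0; they need not be
   open. *)
Definition flc_disk (E : lmodType R) (U : set E) : Prop :=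
  [/\ convex_set U, absorbent U & symmetric_set U].

(* [finest_lc E] is a copy of [E] carrying the finest locally convex topology;
   the algebraic structure is the one of [E]. *)
Definition finest_lc (E : lmodType R) : Type := E.

HB.instance Definition _ (E : lmodType R) := GRing.Lmodule.on (finest_lc E).

(* Neighborhoods of [x] are the supersets of the translates [x + U] of the
   basic neighborhoods of 0, as in every vector space topology. *)
Definition flc_nbhs (E : lmodType R) (x : finest_lc E) :
    set_system (finest_lc E) :=
  filter_from (@flc_disk E) (fun U => [set x + u | u in U]).

HB.instance Definition _ (E : lmodType R) :=
  hasNbhs.Build (finest_lc E) (@flc_nbhs E).

Section Topology.
Variable E : lmodType R.
Implicit Types (U V : set E) (x y : E) (r s t : R).

Lemma convex_setP U : convex_set U <->
  (forall t x y, 0 <= t -> t <= 1 -> U x -> U y -> U (t *: x + (1 - t) *: y)).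
Proof.
split=> [cU t x y t0 t1 Ux Uy|cU x y l /set_mem Ux /set_mem Uy].
- have := cU x y (Itv01 t0 t1) (mem_set Ux) (mem_set Uy).
  by move=> /set_mem.
- by apply/mem_set; apply: (cU l%:num x y).
Qed.

Lemma flc_diskT : flc_disk [set: E].
Proof.
split=> [x y l _ _|x|]; [exact/mem_set| |by move=> ? ? ?].
by exists 1 => //; exists x => //; rewrite scale1r.
Qed.

Lemma flc_disk_sym U r x : flc_disk U -> `|r| <= 1 -> U x -> U (r *: x).
Proof. by move=> [_ _ sU] r1 Ux; apply: (sU r r1); exists x. Qed.

Lemma flc_disk0 U : flc_disk U -> U 0.
Proof.
move=> dU; have [_ aU _] := dU; have [r _ [u Uu _]] := aU 0.
by rewrite -(scale0r u); apply: flc_disk_sym; rewrite // normr0.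
Qed.

Lemma flc_diskZ U r : flc_disk U -> 0 < r -> flc_disk ( *:%R r @` U).
Proof.
move=> dU r0; have [/convex_setP cU aU sU] := dU; split.
- apply/convex_setP => t _ _ t0 t1 [u Uu <-] [v Uv <-].
  exists (t *: u + (1 - t) *: v); first exact: cU.
  by rewrite scalerDr !scalerA [t * r]mulrC [(1 - t) * r]mulrC.
- move=> x; have [s s0 [u Uu <-]] := aU x; exists (s / r).
    by rewrite divr_gt0.
  by exists (r *: u); [exists u|rewrite scalerA divfK// gt_eqF].
- move=> s s1 _ [_ [u Uu <-] <-]; exists (s *: u).
    exact: flc_disk_sym.
  by rewrite !scalerA mulrC.
Qed.

Lemma flc_diskI U V : flc_disk U -> flc_disk V -> flc_disk (U `&` V).
Proof.
move=> dU dV; have [/convex_setP cU aU sU] := dU.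
have [/convex_setP cV aV sV] := dV; split.
- apply/convex_setP => t x y t0 t1 [Ux Vx] [Uy Vy].
  by split; [exact: cU|exact: cV].
- move=> x; have [r r0 [u Uu ru]] := aU x; have [s s0 [v Vv sv]] := aV x.
  have m0 : 0 < r + s by rewrite addr_gt0.
  exists (r + s) => //; exists ((r + s)^-1 *: x).
    split.
      rewrite -ru scalerA; apply: flc_disk_sym => //.
      rewrite mulrC normf_div (gtr0_norm r0) (gtr0_norm m0).
      by rewrite ler_pdivrMr// mul1r lerDl ltW.
    rewrite -sv scalerA; apply: flc_disk_sym => //.
    rewrite mulrC normf_div (gtr0_norm s0) (gtr0_norm m0).
    by rewrite ler_pdivrMr// mul1r lerDr ltW.
  by rewrite scalerA divff ?scale1r// gt_eqF.
- move=> r r1 _ [x [Ux Vx] <-].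
  by split; exact: flc_disk_sym.
Qed.

Lemma flc_diskD U r s u v : flc_disk U -> 0 <= r -> 0 <= s -> U u -> U v ->
  (( *:%R (r + s)) @` U) (r *: u + s *: v).
Proof.
move=> dU r0 s0 Uu Uv; have [/convex_setP cU _ _] := dU.
have [rs0|rs0] := eqVneq (r + s) 0.
  have -> : r = 0 by lra.
  have -> : s = 0 by lra.
  by exists 0; [exact: flc_disk0|rewrite !scale0r scaler0 addr0].
have rs : 0 < r + s by rewrite lt_neqAle eq_sym rs0 addr_ge0.
exists ((r / (r + s)) *: u + (1 - r / (r + s)) *: v).
  apply: cU => //; first by rewrite divr_ge0// ltW.
  by rewrite ler_pdivrMr// mul1r lerDl.
rewrite scalerDr !scalerA; congr (_ *: _ + _ *: _).
  by rewrite mulrC divfK.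
by rewrite mulrBr mulr1 mulrC divfK//; lra.
Qed.

Lemma flc_half U u v : flc_disk U -> ( *:%R 2^-1 @` U) u ->
  ( *:%R 2^-1 @` U) v -> U (u + v).
Proof.
move=> dU [a Ua <-] [b Ub <-].
have h0 : 0 <= 2^-1 :> R by lra.
have [c Uc <-] := flc_diskD dU h0 h0 Ua Ub.
by rewrite (_ : 2^-1 + 2^-1 = 1) ?scale1r//; lra.
Qed.

Lemma flc_nbhs_disk U x : flc_disk U ->
  nbhs (x : finest_lc E) [set x + u | u in U].
Proof. by move=> dU; exists U. Qed.

Fact flc_nbhs_filter (x : finest_lc E) : ProperFilter (nbhs x).
Proof.
apply: filter_from_proper => [|U dU]; last first.
  by exists (x + 0); exists 0 => //; exact: flc_disk0.
apply: filter_from_filter; first by exists setT; exact: flc_diskT.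
move=> U V dU dV; exists (U `&` V); first exact: flc_diskI.
by move=> _ [u [Uu Vu] <-]; split; exists u.
Qed.

Fact flc_nbhs_singleton (x : finest_lc E) (P : set (finest_lc E)) :
  nbhs x P -> P x.
Proof.
move=> [U dU UP]; apply: UP; exists 0; first exact: flc_disk0.
by rewrite addr0.
Qed.

Fact flc_nbhs_nbhs (x : finest_lc E) (P : set (finest_lc E)) :
  nbhs x P -> nbhs x (nbhs^~ P).
Proof.
move=> [U dU UP]; have dV : flc_disk ( *:%R 2^-1 @` U).
  by apply: flc_diskZ => //; lra.
exists ( *:%R 2^-1 @` U) => // _ [v Vv <-].
exists ( *:%R 2^-1 @` U) => // _ [w Vw <-].
apply: UP; exists (v + w); first exact: flc_half.
by rewrite addrA.
Qed.

End Topology.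

HB.instance Definition _ (E : lmodType R) :=
  Nbhs_isNbhsTopological.Build (finest_lc E)
    (@flc_nbhs_filter E) (@flc_nbhs_singleton E) (@flc_nbhs_nbhs E).

Section Tvs.
Variable E : lmodType R.
Local Notation F := (finest_lc E).

Fact flc_add_continuous : continuous (fun x : F * F => x.1 + x.2).
Proof.
move=> [x y] P /= [U dU UP]; have dV : flc_disk ( *:%R 2^-1 @` U).
  by apply: flc_diskZ => //; lra.
exists ([set x + u | u in *:%R 2^-1 @` U], [set y + u | u in *:%R 2^-1 @` U]).
  by split; exact: flc_nbhs_disk.
move=> [_ _] [/= [u Vu <-] [v Vv <-]]; apply: UP; exists (u + v).
  exact: flc_half.
by rewrite addrACA.
Qed.

Fact flc_scale_continuous : continuous (fun z : R^o * F => z.1 *: z.2).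
Proof.
move=> [k x] P /= [U dU UP]; set V := *:%R 2^-1 @` U.
have dV : flc_disk V by apply: flc_diskZ => //; lra.
have [_ aV _] := dV; have [s s0 [v0 Vv0 sv0]] := aV x.
have k1 : 0 < `|k| + 1 by rewrite ltr_wpDl.
have dW : flc_disk ( *:%R (`|k| + 1)^-1 @` V).
  by apply: flc_diskZ => //; rewrite invr_gt0.
exists (ball (k : R^o) (Num.min 1 s^-1),
        [set x + u | u in *:%R (`|k| + 1)^-1 @` V]).
  split; last exact: flc_nbhs_disk.
  by apply: nbhsx_ballx; rewrite lt_min ltr01 invr_gt0.
move=> [l _] [/= + [_ [w Vw <-] <-]].
rewrite /ball/= lt_min => /andP[kl1 kls].
apply: UP; exists ((l - k) *: x + l *: ((`|k| + 1)^-1 *: w)).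
  apply: flc_half => //.
    rewrite -/V -sv0 scalerA; apply: flc_disk_sym => //.
    rewrite normrM (gtr0_norm s0) distrC.
    by move/ltW: kls; rewrite -(ler_pM2r s0) mulVf// gt_eqF.
  rewrite -/V scalerA; apply: flc_disk_sym => //.
  rewrite normrM normfV (gtr0_norm k1) ler_pdivrMr// mul1r.
  have : `|l| <= `|l - k| + `|k| by rewrite -{1}(subrK k l) ler_normD.
  by rewrite distrC in kl1; lra.
by rewrite /= [RHS]scalerDr addrA -scalerDl subrKC.
Qed.

Fact flc_locally_convex : exists2 B : set_system F,
  (forall b, b \in B -> convex_set b) & basis B.
Proof.
exists [set b | open b /\ convex_set b].
  by move=> b /set_mem[].
split=> [b []//|x P [U dU UP]].
have [/convex_setP cU _ _] := dU.
pose b : set F := [set y | exists2 t, 0 <= t < 1 & ( *:%R t @` U) (y - x)].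
exists b; last first.
  move=> y [t /andP[t0 t1] [u Uu tu]]; apply: UP; exists (t *: u).
    by apply: flc_disk_sym => //; rewrite ger0_norm// ltW.
  by rewrite tu addrC subrK.
split; last first.
  exists 0; first by rewrite lexx ltr01.
  by exists 0; [exact: flc_disk0|rewrite scale0r subrr].
split.
  rewrite openE => y [t /andP[t0 t1] [u Uu tu]].
  exists ( *:%R ((1 - t) / 2) @` U); first by apply: flc_diskZ => //; lra.
  move=> _ [_ [v Uv <-] <-]; exists (t + (1 - t) / 2).
    by apply/andP; split; lra.
  have -> : y + ((1 - t) / 2) *: v - x = t *: u + ((1 - t) / 2) *: v.
    by rewrite addrAC -tu.
  by apply: flc_diskD => //; lra.
apply/convex_setP => r y z r0 r1 [t /andP[t0 t1] [u Uu tu]].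
move=> [s /andP[s0 s1] [v Uv sv]].
exists (r * t + (1 - r) * s).
  apply/andP; split; first by nra.
  by case: (leP t s) => ?; nra.
have -> : r *: y + (1 - r) *: z - x = (r * t) *: u + ((1 - r) * s) *: v.
  rewrite -!scalerA tu sv !scalerBr addrACA; congr (_ + _).
  by rewrite -opprD -scalerDl subrKC scale1r.
by apply: flc_diskD => //; nra.
Qed.

End Tvs.

HB.instance Definition _ (E : lmodType R) :=
  PreTopologicalLmod_isTvs.Build R (finest_lc E)
    (@flc_add_continuous E) (@flc_scale_continuous E) (@flc_locally_convex E).

Definition flc_closure (E : lmodType R) (C : set E) : set E :=
  closure (C : set (finest_lc E)).

Definition flc_seq_closure (E : lmodType R) (C : set E) : set E :=
  [set x | exists2 u : nat -> finest_lc E,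
             (forall n, C (u n)) & u @ \oo --> (x : finest_lc E)].

End FinestLocallyConvex.

Section Semiorderings.
Context {A : comNzRingType}.
Implicit Types (P Q : set A) (f g : A).

Definition quadratic_module Q : Prop :=
  [/\ forall f g, Q f -> Q g -> Q (f + g),
      forall f g, Q g -> Q (f ^+ 2 * g) &
      Q 1].

Definition prime_ideal P : Prop :=
  idealr_closed [in P] /\ prime_idealr_closed [in P].

Definition semiordering Q : Prop :=
  [/\ quadratic_module Q,
      Q `|` (-%R @` Q) = setT &
      prime_ideal (Q `&` (-%R @` Q))].

Definition archimedean_qm Q : Prop :=
  forall f, exists k : nat, Q (k%:R + f).

End Semiorderings.

(* Main.v *)
From HB Require Import structures.
Require Import Defs.
From mathcomp Require Import all_boot all_order all_algebra.
From mathcomp Require Import all_classical all_reals all_analysis.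
From mathcomp Require Import ring lra.
Import Order.TTheory GRing.Theory Num.Theory.

Local Open Scope classical_set_scope.
Local Open Scope ring_scope.

(** Sequential limits are produced in one way only: if [f + q / n] lies in [Q]
    for all [n > 0], then [f] is a sequential limit of elements of [Q], since
    [q / n] tends to [0] in every vector space topology.

    If the semiordering [Q] is not archimedean, totality yields an element [p]
    with [p - k] in [Q] for all natural numbers [k].  For any [g], completing
    the square gives
      [(g ^ 2 + p) + n g = (g + n / 2) ^ 2 + (p - n ^ 2 / 4)],
    which lies in [Q] for all [n]; dividing by [n] exhibits [g] as a limit of
    elements of [Q] ([nonarchimedean_seq_closure]).

    If [Q] is archimedean, every [f] is a real constant up to an element that
    is infinitesimal for [Q], by a Dedekind cut argument
    ([standard_part_exists]).  As [-1] is not in [Q], this constant is unique,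
    and since infinitesimals are closed under linear combinations and products,
    taking it is a ring homomorphism [alpha].  The only nontrivial closure
    property is that of squares ([infinitesimal_sqr]).  The half-space
    [alpha >= 0] is closed, because the linear form [alpha] is continuous for
    the finest locally convex topology; and if [alpha f >= 0], then [f + 1 / n]
    is in [Q] for all [n > 0], so [f] is a sequential limit.  Any other
    homomorphism nonnegative on [Q] agrees with [alpha] because both respect
    the same comparisons with rational constants. *)

(** * Sequences in the finest locally convex topology *)

Section Closure.
Set Implicit Arguments.
Unset Strict Implicit.
Context {R : realType} {E : lmodType R}.
Implicit Types (C : set E) (f q : E).

Lemma flc_seq_closure_sub C : flc_seq_closure C `<=` flc_closure C.
Proof.
move=> x [u Cu ux] B /ux [N _ NB].
by exists (u N); split; [exact: Cu|apply: NB => /=].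
Qed.

Lemma flc_seq_closure_harmonic C f q :
  (forall n : nat, C (f + n.+1%:R^-1 *: q)) -> flc_seq_closure C f.
Proof.
move=> Cfq; exists (fun n => f + n.+1%:R^-1 *: q) => //.
move=> B [U dU UB].
have [_ aU _] := dU; have [s s0 [v Uv sv]] := aU q.
(* [q = s v] with [v] in [U], so [q / n] is in [U] as soon as [n >= s]. *)
have [N sN] : exists N : nat, s < N%:R.
  by exists (Num.bound s); rewrite archi_boundP// ltW.
exists N => // n /= Nn; apply: UB; exists (n.+1%:R^-1 *: q) => //.
rewrite -sv scalerA; apply: flc_disk_sym => //.
have n0 : 0 < n.+1%:R :> R by rewrite ltr0n.
rewrite ger0_norm; last by rewrite mulr_ge0 ?invr_ge0// ltW.
rewrite mulrC ler_pdivrMr// mul1r (le_trans (ltW sN))// ler_nat.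
exact: leq_trans Nn (leqnSn n).
Qed.

(** Every linear form is continuous for this topology, whatever the dimension:
    the sets [|a| <= e] with [e > 0] are disks. *)
Lemma flc_closure_half_space C (a : E -> R) :
  (forall c x y, a (c *: x + y) = c * a x + a y) ->
  (forall x, C x -> 0 <= a x) -> forall x, flc_closure C x -> 0 <= a x.
Proof.
move=> alin Ca x Cx; rewrite leNgt; apply/negP => ax.
have a0 : a 0 = 0 by have := alin 1 0 0; rewrite scale1r addr0; lra.
have aZ c y : a (c *: y) = c * a y by rewrite -[c *: y]addr0 alin a0 addr0.
have aD y z : a (y + z) = a y + a z by rewrite -[y in LHS]scale1r alin mul1r.
pose U : set E := [set u | `|a u| <= - a x / 2].
have dU : flc_disk U.
  split.
  - apply/convex_setP => t y z t0 t1; rewrite /U/= !ler_norml aD !aZ.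
    by move=> /andP[? ?] /andP[? ?]; apply/andP; split; nra.
  - move=> y; have r0 : 0 < 2 / - a x * (`|a y| + 1).
      by rewrite mulr_gt0 ?divr_gt0 ?ltr_wpDl//; lra.
    exists (2 / - a x * (`|a y| + 1)) => //.
    exists ((2 / - a x * (`|a y| + 1))^-1 *: y); last first.
      by rewrite scalerA divff ?scale1r// gt_eqF.
    rewrite /U/= aZ normrM gtr0_norm ?invr_gt0// mulrC ler_pdivrMr//.
    rewrite (_ : _ / 2 * _ = `|a y| + 1); first by lra.
    by field; rewrite lt_eqF.
  - move=> r r1 _ [u Uu <-]; rewrite /U/= aZ normrM.
    by apply: le_trans Uu; rewrite ler_piMl.
have [y [/Ca ay [u Uu xu]]] := Cx _ (flc_nbhs_disk x dU).
move: ay Uu; rewrite /U/= -xu aD => ay.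
by rewrite ler_norml => /andP[? ?]; lra.
Qed.

End Closure.

(** * Infinitesimal elements for a quadratic module *)

Section QuadraticModule.
Set Implicit Arguments.
Unset Strict Implicit.
Context {R : realType} {A : comAlgType R} {Q : set A}.
Hypothesis qmQ : quadratic_module Q.
Implicit Types (f g : A) (c e : R).

Lemma quadratic_moduleD f g : Q f -> Q g -> Q (f + g).
Proof. by have [+ _ _] := qmQ; apply. Qed.

(** Nonnegative real constants are squares. *)
Lemma quadratic_moduleZ c f : 0 <= c -> Q f -> Q (c *: f).
Proof.
move=> c0 Qf; have [_ sqQ _] := qmQ.
have := sqQ (Num.sqrt c)%:A f Qf.
by rewrite exprZn expr1n mulr_algl sqr_sqrtr.
Qed.

Lemma quadratic_module_sqr f : Q (f ^+ 2).
Proof. by have [_ + Q1] := qmQ => /(_ f 1 Q1); rewrite mulr1. Qed.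

Lemma quadratic_module_const c : 0 <= c -> Q c%:A.
Proof. by move=> c0; apply: quadratic_moduleZ => //; have [] := qmQ. Qed.

Definition infinitesimal f : Prop :=
  forall e, 0 < e -> Q (e%:A + f) /\ Q (e%:A - f).

Lemma infinitesimalD f g :
  infinitesimal f -> infinitesimal g -> infinitesimal (f + g).
Proof.
move=> If Ig e e0; have e2 : 0 < e / 2 by lra.
have [f1 f2] := If _ e2; have [g1 g2] := Ig _ e2.
have -> : e%:A = (e / 2)%:A + (e / 2)%:A :> A.
  by rewrite -scalerDl; congr (_ *: _); lra.
split; first by rewrite addrACA; exact: quadratic_moduleD.
by rewrite opprD addrACA; exact: quadratic_moduleD.
Qed.

Lemma infinitesimal0 : infinitesimal 0.
Proof.
by move=> e e0; rewrite oppr0 addr0; split; apply: quadratic_module_const; lra.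
Qed.

Lemma infinitesimalN f : infinitesimal f -> infinitesimal (- f).
Proof. by move=> If e /If[]; rewrite opprK. Qed.

Lemma infinitesimalZ c f : infinitesimal f -> infinitesimal (c *: f).
Proof.
have pos d : 0 < d -> infinitesimal f -> infinitesimal (d *: f).
  move=> d0 If e e0; have [|f1 f2] := If (e / d); first by rewrite divr_gt0.
  have -> : e%:A = d *: (e / d)%:A :> A by rewrite scalerA mulrC divfK ?gt_eqF.
  by rewrite -scalerBr -scalerDr; split; apply: quadratic_moduleZ; rewrite ?ltW.
move=> If; have [c0|c0|->] := ltgtP c 0.
- by rewrite -[c]opprK scaleNr; apply/infinitesimalN/pos => //; lra.
- exact: pos.
- by rewrite scale0r; exact: infinitesimal0.
Qed.

(** From [e + f] and [e - f] in [Q], the element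
    [(e - f) ^ 2 (e + f) + (e + f) ^ 2 (e - f) = 2 e (e ^ 2 - f ^ 2)]
    is in [Q], which bounds [f ^ 2] by [e ^ 2]. *)
Lemma infinitesimal_sqr f : infinitesimal f -> infinitesimal (f ^+ 2).
Proof.
move=> If d d0; split.
  apply: quadratic_moduleD; last exact: quadratic_module_sqr.
  by apply: quadratic_module_const; exact: ltW.
have e0 : 0 < Num.sqrt d by rewrite sqrtr_gt0.
have [f1 f2] := If _ e0; have [_ sqQ _] := qmQ.
rewrite -[d]sqr_sqrtr ?ltW//; move: (Num.sqrt d) e0 f1 f2 => e e0 f1 f2.
have := quadratic_moduleD (sqQ (e%:A - f) _ f1) (sqQ (e%:A + f) _ f2).
have -> : (e%:A - f) ^+ 2 * (e%:A + f) + (e%:A + f) ^+ 2 * (e%:A - f) =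
          e%:A * (2%:R * (e%:A ^+ 2 - f ^+ 2)) by ring.
rewrite mulr_algl mulr_natl -scaler_nat scalerA => QQ.
have e2 : 0 <= (e * 2%:R)^-1 by rewrite invr_ge0; lra.
have := quadratic_moduleZ e2 QQ.
rewrite scalerA mulVf ?scale1r; last by rewrite gt_eqF//; lra.
by rewrite exprZn expr1n.
Qed.

Lemma infinitesimalM f g :
  infinitesimal f -> infinitesimal g -> infinitesimal (f * g).
Proof.
move=> If Ig.
have -> : f * g = (2^-1 : R) *: ((f + g) ^+ 2 - f ^+ 2 - g ^+ 2).
  have -> : (f + g) ^+ 2 - f ^+ 2 - g ^+ 2 = 2%:R * (f * g) by ring.
  by rewrite mulr_natl -[X in _ *: X]scaler_nat scalerA mulVf ?scale1r// pnatr_eq0.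
apply: infinitesimalZ; rewrite -addrA -opprD; apply: infinitesimalD.
  by apply: infinitesimal_sqr; exact: infinitesimalD.
by apply: infinitesimalN; apply: infinitesimalD; exact: infinitesimal_sqr.
Qed.

Hypothesis QN1 : ~ Q (-1).

Lemma quadratic_module_const_ge0 c : Q c%:A -> 0 <= c.
Proof.
move=> Qc; rewrite leNgt; apply/negP => c0; apply: QN1.
have c1 : 0 <= (- c)^-1 by rewrite invr_ge0; lra.
have := quadratic_moduleZ c1 Qc.
by rewrite scalerA invrN mulNr mulVf ?lt_eqF// scaleN1r.
Qed.

Lemma infinitesimal_const c : infinitesimal c%:A -> c = 0.
Proof.
move=> Ic; apply/eqP; case: (ltgtP c 0) => // c0.
- have [|+ _] := Ic (- c / 2); first by lra.
  by rewrite -scalerDl => /quadratic_module_const_ge0; lra.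
- have [|_ +] := Ic (c / 2); first by lra.
  by rewrite -scalerBl => /quadratic_module_const_ge0; lra.
Qed.

(** * The standard part *)

(** The standard part of [f] is the cut [sup {r | f - r in Q}]; the archimedean
    property makes it finite, and totality of [Q] gives the upper estimate. *)
Lemma standard_part_exists :
  Q `|` (-%R @` Q) = setT -> archimedean_qm Q ->
  forall f, exists c, infinitesimal (f - c%:A).
Proof.
move=> totQ archQ f; pose S := [set r : R | Q (f - r%:A)].
have [k Qk] := archQ f; have [l Ql] := archQ (- f).
have ubS : ubound S l%:R.
  move=> r Sr; rewrite -subr_ge0; apply: quadratic_module_const_ge0.
  have := quadratic_moduleD Ql Sr.
  by rewrite addrA addrNK scalerBl scaler_nat.
have supS : has_sup S.
  split; last by exists l%:R.
  by exists (- k%:R); rewrite /S/= scaleNr opprK scaler_nat addrC.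
exists (sup S) => e e0; split.
- have [r Sr lt_r] := sup_adherent e0 supS.
  have -> : e%:A + (f - (sup S)%:A) = (f - r%:A) + (r - (sup S - e))%:A.
    by rewrite !scalerBl; ring.
  by apply: quadratic_moduleD Sr _; apply: quadratic_module_const; lra.
- have : (Q `|` -%R @` Q) (f - (sup S + e)%:A) by rewrite totQ.
  case=> [Sse|[q Qq eq_q]].
    have : sup S + e <= sup S by apply: ub_le_sup => //; exists l%:R.
    by lra.
  suff -> : e%:A - (f - (sup S)%:A) = q by [].
  by rewrite -[q]opprK eq_q scalerDl; ring.
Qed.

Lemma standard_part_unique f c d :
  infinitesimal (f - c%:A) -> infinitesimal (f - d%:A) -> c = d.
Proof.
move=> Ic Id; apply/eqP; rewrite -subr_eq0; apply/eqP; apply: infinitesimal_const.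
have -> : (c - d)%:A = (f - d%:A) - (f - c%:A) by rewrite scalerBl; ring.
by apply: infinitesimalD => //; exact: infinitesimalN.
Qed.

Lemma standard_part_rmorphism :
  Q `|` (-%R @` Q) = setT -> archimedean_qm Q ->
  exists alpha : {rmorphism A -> R}, forall f, infinitesimal (f - (alpha f)%:A).
Proof.
move=> totQ archQ.
have [a aP] := choice (standard_part_exists totQ archQ).
have aB : zmod_morphism a.
  move=> f g; apply: (@standard_part_unique (f - g)) (aP _) _.
  have -> : f - g - (a f - a g)%:A = (f - (a f)%:A) - (g - (a g)%:A).
    by rewrite scalerBl; ring.
  by apply: infinitesimalD => //; exact: infinitesimalN.
have aM : monoid_morphism a.
  split=> [|f g].
    apply: (@standard_part_unique 1) (aP _) _.
    by rewrite scale1r subrr; exact: infinitesimal0.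
  apply: (@standard_part_unique (f * g)) (aP _) _.
  have -> : f * g - (a f * a g)%:A =
      a f *: (g - (a g)%:A) + a g *: (f - (a f)%:A)
      + (f - (a f)%:A) * (g - (a g)%:A).
    rewrite -scalerA -(mulr_algl (a f) (_ *: _)).
    by rewrite -(mulr_algl (a f) (_ - _)) -(mulr_algl (a g) (_ - _)); ring.
  by apply: infinitesimalD; [apply: infinitesimalD; exact: infinitesimalZ|
                             exact: infinitesimalM].
pose mA := GRing.isZmodMorphism.Build A R a aB.
pose mM := GRing.isMonoidMorphism.Build A R a aM.
pose alpha : {rmorphism A -> R} := HB.pack a mA mM.
by exists alpha.
Qed.

Lemma standard_part_ge0 f c : infinitesimal (f - c%:A) -> Q f -> 0 <= c.
Proof.
move=> Ic Qf; rewrite leNgt; apply/negP => c0.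
have [|_ Qe] := Ic (- c / 2); first by lra.
have := quadratic_moduleD Qe Qf.
have -> : (- c / 2)%:A - (f - c%:A) + f = (c / 2)%:A.
  by rewrite (_ : c / 2 = - c / 2 + c) ?scalerDl; [ring|lra].
by move/quadratic_module_const_ge0; lra.
Qed.

(** A ring homomorphism to [R] is only known to fix the rational constants, so
    the comparison passes through a rational strictly between two reals. *)
Lemma standard_part_rmorphism_unique (beta : {rmorphism A -> R}) f c :
  Q `<=` beta @^-1` [set r | 0 <= r] -> infinitesimal (f - c%:A) -> beta f = c.
Proof.
move=> Qbeta Ic.
have betaq (q : rat) : beta (ratr q)%:A = ratr q :> R.
  exact: (fmorph_rat (beta \o in_alg A)).
apply/eqP; case: (ltgtP (beta f) c) => // bc.
- have [q] := rat_in_itvoo bc; rewrite in_itv/= => /andP[bq qc].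
  have [|+ _] := Ic (c - ratr q); first by lra.
  rewrite scalerBl [_ + _]addrC addrA subrK.
  by move=> /Qbeta/=; rewrite rmorphB/= betaq; lra.
- have [q] := rat_in_itvoo bc; rewrite in_itv/= => /andP[cq qb].
  have [|_ +] := Ic (ratr q - c); first by lra.
  rewrite scalerBl opprB addrA subrK.
  by move=> /Qbeta/=; rewrite rmorphB/= betaq; lra.
Qed.

(** Real-linearity of [alpha] comes from its values on the constants, which are
    their own standard parts. *)
Lemma standard_part_linear (alpha : {rmorphism A -> R}) :
  (forall f, infinitesimal (f - (alpha f)%:A)) ->
  forall c f g, alpha (c *: f + g) = c * alpha f + alpha g.
Proof.
move=> Ialpha c f g; rewrite rmorphD -mulr_algl rmorphM/=; congr (_ * _ + _).
apply: (@standard_part_unique c%:A) (Ialpha _) _.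
by rewrite subrr; exact: infinitesimal0.
Qed.

Lemma standard_part_seq_closure f c :
  infinitesimal (f - c%:A) -> 0 <= c -> flc_seq_closure Q f.
Proof.
move=> Ic c0; apply: (@flc_seq_closure_harmonic _ _ _ _ 1) => n.
have [|Qe _] := Ic n.+1%:R^-1; first by rewrite invr_gt0 ltr0n.
have -> : f + n.+1%:R^-1 *: 1 = n.+1%:R^-1 *: 1 + (f - c%:A) + c%:A by ring.
by apply: quadratic_moduleD Qe _; exact: quadratic_module_const.
Qed.

End QuadraticModule.

(** * Non-archimedean semiorderings *)

Lemma semiordering_notN1 (A : comNzRingType) (Q : set A) :
  semiordering Q -> ~ Q (-1).
Proof.
move=> [[_ _ Q1] _ [[_ /negP proper _] _]] QN1; apply: proper; rewrite in_setE.
by split=> //; exists (-1); rewrite ?opprK.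
Qed.

(** A single [q = g ^ 2 + p] has to serve for all [n], so that [q / n] tends to
    [0]; hence the need for an element [p] that exceeds every real constant.
    In the proof [p] is [- f]. *)
Lemma nonarchimedean_seq_closure (R : realType) (A : comAlgType R) (Q : set A) :
  quadratic_module Q -> Q `|` (-%R @` Q) = setT -> ~ archimedean_qm Q ->
  flc_seq_closure Q = setT.
Proof.
move=> qmQ totQ /existsNP[f /forallNP nQf]; apply/seteqP; split=> // g _.
have Qk k : Q (- f - k%:R).
  have : (Q `|` -%R @` Q) (k%:R + f) by rewrite totQ.
  by case=> [/nQf//|[q Qq eq_q]]; rewrite addrC -opprD -eq_q opprK.
have Qc (c : R) : 0 <= c -> Q (- f - c%:A).
  move=> c0; have -> : - f - c%:A = (- f - (Num.bound c)%:R)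
                                    + ((Num.bound c)%:R - c)%:A.
    by rewrite scalerBl scaler_nat; ring.
  apply: (quadratic_moduleD qmQ) => //; apply: (quadratic_module_const qmQ).
  by rewrite subr_ge0 ltW// archi_boundP.
apply: (@flc_seq_closure_harmonic _ _ _ _ (g ^+ 2 - f)) => n.
set r : R := n.+1%:R; have r0 : 0 < r by rewrite ltr0n.
pose h : A := (r / 2)%:A.
have -> : g + r^-1 *: (g ^+ 2 - f) = r^-1 *: ((g + h) ^+ 2 + (- f - h ^+ 2)).
  rewrite -[X in X + _]scale1r -(mulVf (lt0r_neq0 r0)) -scalerA -scalerDr.
  have -> : r *: g = 2%:R * h * g.
    rewrite mulr_natl -scaler_nat scalerA mulr_algl; congr (_ *: _).
    by rewrite mulrC divfK.
  by congr (_ *: _); ring.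
apply: (quadratic_moduleZ qmQ); first by rewrite invr_ge0 ltW.
apply: (quadratic_moduleD qmQ); first exact: quadratic_module_sqr.
by rewrite exprZn expr1n; apply: Qc; exact: sqr_ge0.
Qed.

Theorem proposition2p2 (R : realType) (A : comAlgType R) (Q : set A)
    (semiordQ : semiordering Q) :
  (~ archimedean_qm Q ->
     flc_seq_closure Q = flc_closure Q /\ flc_closure Q = [set: A]) /\
  (archimedean_qm Q ->
     exists alpha : {rmorphism A -> R},
       [/\ Q `<=` alpha @^-1` [set r | 0 <= r],
           forall beta : {rmorphism A -> R},
             Q `<=` beta @^-1` [set r | 0 <= r] -> beta =1 alpha,
           flc_seq_closure Q = flc_closure Q &
           flc_closure Q = alpha @^-1` [set r | 0 <= r]]).
Proof.
have QN1 := semiordering_notN1 semiordQ.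
have [qmQ totQ _] := semiordQ.
have sub := @flc_seq_closure_sub _ A Q.
split=> [nArch|arch].
  have seqT := nonarchimedean_seq_closure qmQ totQ nArch.
  suff clT : flc_closure Q = setT by rewrite seqT clT.
  by apply/seteqP; split=> // x _; apply: sub; rewrite seqT.
have [alpha Ialpha] := standard_part_rmorphism qmQ QN1 totQ arch.
have Qalpha : Q `<=` alpha @^-1` [set r | 0 <= r].
  by move=> f; exact: (standard_part_ge0 qmQ QN1) (Ialpha f).
have clos : flc_closure Q `<=` alpha @^-1` [set r | 0 <= r].
  by apply: flc_closure_half_space Qalpha; exact: standard_part_linear Ialpha.
have seqc : alpha @^-1` [set r | 0 <= r] `<=` flc_seq_closure Q.
  by move=> f; exact: (standard_part_seq_closure qmQ) (Ialpha f).
exists alpha; split=> //.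
- move=> beta Qbeta f.
  exact: (standard_part_rmorphism_unique Qbeta (Ialpha f)).
- by apply/seteqP; split=> // f /clos/seqc.
- by apply/seteqP; split=> // f /seqc/sub.
Qed.
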